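(* Let $n\ge 1$ and let $\pi\in S_n$ be a permutation with pinnacle set $S$, where $|S|=p$. Then there is a sequence $R$ of reversals, each of which is balanced for the permutation to which it is applied, transforming $\pi$ into the canonical permutation $\mathit{Id}_S\in S_n$. If $p\ge 1$, $R$ consists of at most $2n-\min\{p,3\}$ balanced reversals; if $p=0$, $R$ consists of at most $2n-1$ balanced reversals.
   Context: Convention: a permutation $\pi=(\pi_1\,\pi_2\,\ldots\,\pi_n)\in S_n$ is always extended by $\pi_0=n+1$ and $\pi_{n+1}=n+2$. A pinnacle of $\pi$ is an element $\pi_i$ with $1\le i\le n$ and $\pi_{i-1}<\pi_i>\pi_{i+1}$; the pinnacle set of $\pi$ is the set of its pinnacles. For elements $w_1=\pi_a$, $w_2=\pi_b$ with $1\le a\le b\le n$, the reversal $\rho(w_1,w_2)$ transforms $\pi=(\pi_0\ldots\pi_{a-1}\,\pi_a\ldots\pi_b\,\pi_{b+1}\ldots\pi_{n+1})$ into $\pi\cdot\rho(w_1,w_2)=(\pi_0\ldots\pi_{a-1}\,\pi_b\,\pi_{b-1}\ldots\pi_a\,\pi_{b+1}\ldots\pi_{n+1})$. The reversal $\rho(w_1,w_2)$ is balanced for $\pi$ if $\pi$ and $\pi\cdot\rho(w_1,w_2)$ have the same pinnacle set. Canonical permutation: for $S=\{s_1<s_2<\ldots<s_d\}\subseteq\{1,\ldots,n\}$ with $n>2d$, $\mathit{Id}_S\in S_n$ is obtained by placing the elements of $S$ in increasing order at positions $2,4,\ldots,2d$ and the elements of $\{1,\ldots,n\}\setminus S$ in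 increasing order at positions $1,3,\ldots,2d-1,2d+1,2d+2,\ldots,n$ (and, by the convention, $n+1$ and $n+2$ are added at the beginning and end). *)

(* Defs.v *)
From mathcomp Require Import all_boot all_fingroup.
From mathcomp Require Import zify.

Set Implicit Arguments.
Unset Strict Implicit.
Unset Printing Implicit Defensive.

(* A permutation of {1, ..., n} is an element of 'S_n, where i : 'I_n stands
   both for the position i.+1 and for the value i.+1. *)

(* [ext pi k] is the entry, as an integer, at position k of the extended word
   (n+1, pi_1, ..., pi_n, n+2); every k > n gets the value n+2. *)
Definition ext (n : nat) (pi : 'S_n) (k : nat) : nat :=
  if k == 0 then n.+1
  else oapp (fun i : 'I_n => (pi i).+1) n.+2 (insub k.-1).

(* The index i : 'I_n is the position i.+1, with neighbours i and i.+2. *)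
Definition pinnacle_set (n : nat) (pi : 'S_n) : {set 'I_n} :=
  [set pi i | i : 'I_n & (ext pi i < ext pi i.+1) && (ext pi i.+2 < ext pi i.+1)].

Definition revpos (n : nat) (a b i : 'I_n) : 'I_n :=
  if a <= i <= b then insubd i (a + b - i) else i.

Lemma revposK (n : nat) (a b : 'I_n) : involutive (revpos a b).
Proof.
move=> i; rewrite [revpos a b i]/revpos.
case: ifPn => hi; last by rewrite /revpos (negbTE hi).
have hn : a + b - i < n by have := ltn_ord b; lia.
have hv : val (insubd i (a + b - i)) = a + b - i by rewrite val_insubd hn.
rewrite /revpos hv.
have -> : a <= a + b - i <= b by lia.
apply: val_inj; rewrite val_insubd hv /=; have := ltn_ord i.
by case: ifP; lia.
Qed.

Definition revpos_perm (n : nat) (a b : 'I_n) : 'S_n :=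
  perm (inv_inj (revposK a b)).

Definition position (n : nat) (pi : 'S_n) (w : 'I_n) : 'I_n := (pi^-1)%g w.

(* (s * t)%g first applies s, so this is i |-> pi (revpos a b i), with a and b
   the positions of w1 and w2. *)
Definition reversal (n : nat) (pi : 'S_n) (w1 w2 : 'I_n) : 'S_n :=
  (revpos_perm (position pi w1) (position pi w2) * pi)%g.

Definition balanced (n : nat) (pi : 'S_n) (w1 w2 : 'I_n) : bool :=
  (position pi w1 <= position pi w2) &&
  (pinnacle_set (reversal pi w1 w2) == pinnacle_set pi).

(* A pair (w1, w2) in R stands for the reversal rho(w1, w2). *)
Fixpoint apply_reversals (n : nat) (pi : 'S_n) (R : seq ('I_n * 'I_n)) : 'S_n :=
  if R is w :: R' then apply_reversals (reversal pi w.1 w.2) R' else pi.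

Fixpoint all_balanced (n : nat) (pi : 'S_n) (R : seq ('I_n * 'I_n)) : bool :=
  if R is w :: R' then
    balanced pi w.1 w.2 && all_balanced (reversal pi w.1 w.2) R'
  else true.

(* The enumeration of a set of ordinals is increasing.  Positions are counted
   from 0 here, so the elements of S go to the odd i < 2 * #|S|. *)
Definition canonical_fun (n : nat) (S : {set 'I_n}) (i : 'I_n) : 'I_n :=
  if i < 2 * #|S| then
    if odd i then nth i (enum S) i./2 else nth i (enum (~: S)) i./2
  else nth i (enum (~: S)) (i - #|S|).

(* The permutation Id_S.  The default value 1 is only used when canonical_fun S
   is not injective, which does not happen if 2 * #|S| < n (canonicalE). *)
Definition canonical (n : nat) (S : {set 'I_n}) : 'S_n :=
  insubd (1%g : 'S_n) (finfun (canonical_fun S)).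

Lemma canonical_fun_inj (n : nat) (S : {set 'I_n}) :
  2 * #|S| < n -> injective (canonical_fun S).
Proof.
move=> hS.
have hC : #|~: S| = n - #|S| by have := cardsC S; rewrite card_ord; lia.
pose idx (i : 'I_n) := if i < 2 * #|S| then i./2 else i - #|S|.
pose inS (i : 'I_n) := (i < 2 * #|S|) && odd i.
have fE i : canonical_fun S i =
    if inS i then nth i (enum S) (idx i) else nth i (enum (~: S)) (idx i).
  by rewrite /canonical_fun /inS /idx; case: ifP => //= _; case: ifP.
have sz i : if inS i then idx i < size (enum S) else idx i < size (enum (~: S)).
  rewrite -!cardE hC /inS /idx; move: hS; move: #|S| => d hd; have := ltn_ord i; have := odd_double_half i.
  by case: (ltnP i (2 * d)) => /= ?; case: (odd i) => /=; lia.
have memS i : (canonical_fun S i \in S) = inS i.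
  rewrite fE; have := sz i; case: ifP => _ hs.
    by rewrite -mem_enum mem_nth.
  by have := mem_nth i hs; rewrite mem_enum in_setC => /negbTE.
move=> i j eqf; have eS : inS i = inS j by rewrite -!memS eqf.
have eidx : idx i = idx j.
  move: eqf; rewrite !fE -eS; have := sz i; have := sz j; rewrite -eS.
  case: ifP => _ hj hi /eqP; rewrite (set_nth_default i j hj);
    by rewrite nth_uniq ?enum_uniq // => /eqP.
apply: val_inj => /=; move: eS eidx; rewrite /inS /idx; move: #|S| => d.
have := odd_double_half i; have := odd_double_half j.
case: (ltnP i (2 * d)) => ?; case: (ltnP j (2 * d)) => ? /=;
  by case: (odd i) (odd j) => [] [] //= *; lia.
Qed.

Lemma canonicalE (n : nat) (S : {set 'I_n}) :
  2 * #|S| < n -> canonical S =1 canonical_fun S.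
Proof.
move=> hS i; rewrite /canonical.
have inj : injectiveb (finfun (canonical_fun S)).
  by apply/injectiveP => x y; rewrite !ffunE; exact: canonical_fun_inj.
by rewrite -pvalE val_insubd inj ffunE.
Qed.

(* Main.v *)
Require Import Defs.
From mathcomp Require Import all_boot all_fingroup.
From mathcomp Require Import zify.

Set Implicit Arguments.
Unset Strict Implicit.
Unset Printing Implicit Defensive.

(** Let s_1 < s_2 < ... be the values in S and c_1 < c_2 < ... those outside S.
The non-pinnacles are settled at the right end in decreasing order, until only
the p + 1 small ones c_1, ..., c_(p+1) are left.
Let x be the largest unsettled non-pinnacle, and y the last unsettled entry.
- If only the left neighbour of x exceeds x, reversing x ... y settles x.
- If only the right one does, reversing the whole prefix that ends with x leads
  to the first case.
- Otherwise x is alone between two pinnacles or borders, so by counting some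
  other stretch between pinnacles contains two small values; one reversal cuts
  that stretch between them and attaches one of the parts to x.  The number of
  pairs of small values that are consecutive among pinnacles and small values
  drops by one, so this happens at most p + 1 times.
The unsettled word then alternates between non-pinnacles and pinnacles.  Let d
be its first entry.  While d differs from c_1, reverse from d up to just before
the first pinnacle after c_1 that exceeds d: the new first entry is smaller than
d, so at most p reversals bring c_1 to the front.  Finally s_1, c_2, s_2, ... are
brought to their places one after the other, one reversal each.  In total at most
2 (n - 2p - 1) + (p + 1) + p + 2 max (p - 1, 0) reversals are used. *)

(** * Pairs of equal adjacent bits *)

(* [p] is the bit that precedes [b]; counts adjacent pairs of bits equal to [x]. *)
Fixpoint adj (x p : bool) (b : seq bool) : nat :=
  if b is y :: b' then ((p == x) && (y == x)) + adj x y b' else 0.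

Lemma adj_cat x p a b : adj x p (a ++ b) = adj x p a + adj x (last p a) b.
Proof. by elim: a p => //= y a IH p; rewrite IH addnA. Qed.

(** The pairs true-false are counted in two ways, by their first and by their second entry. *)
Lemma adj_balance p b :
  adj true p b + count negb b + last p b = adj false p b + count id b + p.
Proof. by elim: b p => [|y b IH] p /=; [lia | have := IH y; case: p y {IH} => [] []; lia]. Qed.

Lemma adj_prev b p : adj false p b = adj false true b + (~~ p && ~~ head true b).
Proof. by case: b => [|y b] /=; case: p => //=; case: y => //=; lia. Qed.

(** A leading [true] forms no pair of [false] bits, so each part is counted by itself and only the
    junction is added. *)
Lemma adjF_cat a b :
  adj false true (a ++ b) =
  adj false true a + adj false true b + (~~ last true a && ~~ head true b).
Proof. by rewrite adj_cat (adj_prev b (last true a)) addnA. Qed.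

Lemma adjF_rev b : adj false true (rev b) = adj false true b.
Proof.
elim: b => //= y b IH; rewrite rev_cons -cats1 adjF_cat IH /=.
rewrite (adj_prev b y); case: b {IH} => [|z b] /=; first by case: y.
by rewrite rev_cons last_rcons; case: y z => [] []; lia.
Qed.

(** * Words with prescribed peaks *)

Section Words.

Variables (S : pred nat).

Definition peak_ok (a b c : nat) : bool := S b == (a < b) && (c < b).

Fixpoint has_peaks (l : nat) (w : seq nat) (r : nat) : bool :=
  if w is b :: w' then peak_ok l b (head r w') && has_peaks b w' r else true.

Lemma has_peaks_cat l u v r :
  has_peaks l (u ++ v) r = has_peaks l u (head r v) && has_peaks (last l u) v r.
Proof. by elim: u l => //= b u IH l; rewrite IH andbA; case: u {IH}. Qed.

Lemma has_peaks_rev l u r : has_peaks l (rev u) r = has_peaks r u l.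
Proof.
elim: u l r => //= b u IH l r; rewrite rev_cons -cats1 has_peaks_cat IH /= andbT andbC.
congr (_ && _); rewrite /peak_ok [X in _ == X]andbC; congr (_ == _ && (_ < _)).
by case: u {IH} => //= c u; rewrite rev_cons last_rcons.
Qed.

(* Replacing the neighbour x of the entry a by y cannot change whether a is a
   peak.  In the second alternative a does not become one because of y. *)
Definition compat (a x y : nat) : bool :=
  ((y < a) == (x < a)) || (~~ S a && (a <= y)).

Lemma compat_gt a x y : x < a -> y < a -> compat a x y.
Proof. by rewrite /compat => -> ->. Qed.

Lemma compat_le a x y : ~~ S a -> a <= y -> compat a x y.
Proof. by rewrite /compat => -> ->; rewrite orbT. Qed.

Lemma has_peaks_compatl l l' u r :
  has_peaks l u r -> u = [::] \/ compat (head 0 u) l l' -> has_peaks l' u r.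
Proof.
case: u => //= b u /andP[h ->] [//|hc]; rewrite andbT; move: h hc.
by rewrite /peak_ok /compat; case: (S b) => /=; lia.
Qed.

Lemma has_peaks_compatr l u r r' :
  has_peaks l u r -> u = [::] \/ compat (last 0 u) r r' -> has_peaks l u r'.
Proof.
rewrite -2![has_peaks l u _]has_peaks_rev => h hc; apply: has_peaks_compatl h _.
case: hc => [->|]; [by left | right].
by move: b; case/lastP: u => // u b; rewrite rev_rcons /= last_rcons.
Qed.

(** Inside [B] the two neighbours of an entry only swap sides, which does not affect peaks. The
    entries at the two cuts see a new neighbour, and one [compat] condition covers each of them. *)
Lemma has_peaks_reversal l A B C r :
  has_peaks l (A ++ B ++ C) r -> B != [::] ->
  A = [::] \/ compat (last l A) (head 0 B) (last 0 B) ->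
  compat (head 0 B) (last l A) (head r C) ->
  compat (last 0 B) (head r C) (last l A) ->
  C = [::] \/ compat (head r C) (last 0 B) (head 0 B) ->
  has_peaks l (A ++ rev B ++ C) r.
Proof.
case/lastP: B => // B y; rewrite !has_peaks_cat !last_rcons rev_rcons.
case/and3P=> hA hB hC _ cA cb cy cC.
have hh : head 0 (rcons B y) = head 0 (rev (y :: rev B)) by rewrite rev_cons revK.
apply/and3P; split.
- apply: has_peaks_compatr hA _; case: cA => [->|]; [by left|].
  move: hB hC cb cy cC hh => _ _ _ _ _ _; case: A => [|a A] cA; [by left | right].
  by case: B cA.
- rewrite -rev_rcons has_peaks_rev; apply: has_peaks_compatl (_ : has_peaks (last l A) _ _) _.
    by apply: has_peaks_compatr hB _; right; rewrite last_rcons.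
  by right.
- rewrite /=.
  have -> : last y (rev B) = head 0 (rcons B y).
    by elim: (B) => [|? ? _] //=; rewrite rev_cons last_rcons.
  apply: has_peaks_compatl hC _.
  case: cC => [->|]; [by left |]; case: C {hA hB cb cy} => [|c C]; by [left|right].
Qed.

End Words.

(** * Sequences of peak-preserving reversals *)

Section Sorting.

(** [h] and [h'] are the border entries before and after the word, later [n] and [n.+1]. *)
Variables (S : pred nat) (h h' : nat).
Hypotheses (S_lt : forall y, S y -> y < h) (hh : h <= h').

(* An empty B is allowed, so a step may do nothing. *)
Inductive reach : nat -> seq nat -> seq nat -> Prop :=
| reach_refl k w : reach k w w
| reach_step k A B C w : has_peaks S h (A ++ rev B ++ C) h' ->
    reach k (A ++ rev B ++ C) w -> reach k.+1 (A ++ B ++ C) w.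

Lemma reach_trans k m u v w : reach k u v -> reach m v w -> reach (k + m) u w.
Proof.
move=> ruv; elim: ruv m w => {k u v} [k u|k A B C v hp _ IH] m w hv.
  (* The first sequence is empty; it remains to weaken the bound of the second one, and [reach_refl]
     holds with any bound. *)
  elim: hv k => {m u w} [m u|m A B C w hp _ IH] k; first exact: reach_refl.
  by rewrite addnS; apply: reach_step.
by rewrite addSn; apply: reach_step => //; apply: IH.
Qed.

Lemma reach_le k m u v : k <= m -> reach k u v -> reach m u v.
Proof. by move=> /subnKC <- r; apply: reach_trans r (reach_refl _ _). Qed.

Lemma reach1 A B C : has_peaks S h (A ++ rev B ++ C) h' ->
  reach 1 (A ++ B ++ C) (A ++ rev B ++ C).
Proof. by move=> hp; apply: reach_step hp _; apply: reach_refl. Qed.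

(** * Small values and the state of the sorting process *)

(* [K] stands for the list of small values, none of which is in [S]. *)
Definition kbits (K : seq nat) u := [seq S y | y <- u & S y || (y \in K)].

Lemma kbits_cat K u v : kbits K (u ++ v) = kbits K u ++ kbits K v.
Proof. by rewrite /kbits filter_cat map_cat. Qed.

Lemma kbits_rev K u : kbits K (rev u) = rev (kbits K u).
Proof. by rewrite /kbits filter_rev map_rev. Qed.

(** The potential of the settling phase. The leading [true] makes the border count as a pinnacle. *)
Definition surplus K u := adj false true (kbits K u).

(** Entries without a bit may separate the two small values of a counted pair, so the cut is
    described by the last bit before it and the first bit after it. *)
Lemma cut_between_small K p u : 0 < adj false p (kbits K u) ->
  exists A B, [/\ u = A ++ B, last p (kbits K A) = false &
                  head true (kbits K B) = false].
Proof.
elim: u p => // y u IH p.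
case E : (~~ p && ~~ head true (kbits K (y :: u))).
  by case/andP: E => /negbTE hp /negbTE hq _; exists [::], (y :: u).
rewrite adj_prev E addn0 => hs.
have [] := IH (if S y || (y \in K) then S y else p).
  move: hs E; rewrite /kbits /=; case Sy: (S y); case: (y \in K); rewrite /= ?Sy ?add0n //.
  by rewrite [adj false p _]adj_prev => hs ->; rewrite addn0.
move=> A [B [-> hA hB]]; exists (y :: A), B; split=> //; move: hA.
by rewrite /kbits /=; case: (S y || _).
Qed.

(* u is the unsettled part and T the settled end of the word; C and Q list the
   values of u outside and inside S. *)
Record state (u T C Q : seq nat) : Prop := State {
  st_peaks : has_peaks S h (u ++ T) h';
  st_low : perm_eq (filter (predC S) u) C;
  st_high : perm_eq (filter S u) Q;
  st_uniq : uniq u;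
  st_last : ~~ S (last h u);
  st_sorted : sorted ltn (C ++ T);
  st_lt : all (gtn h) (C ++ T);
  st_T : all (predC S) T }.

Lemma state_mem u T C Q y : state u T C Q -> ~~ S y -> (y \in u) = (y \in C).
Proof. by case=> _ hC _ _ _ _ _ _ hy; rewrite -(perm_mem hC) mem_filter /= hy. Qed.

Lemma state_max u T C x Q : state u T (rcons C x) Q ->
  [/\ ~~ S x, x \in u, forall y, y \in u -> ~~ S y -> y <= x, x < head h' T & x < h].
Proof.
move=> st; have := st_sorted st; have := st_lt st.
rewrite all_cat all_rcons /= => /andP[/andP[xh _] hT].
rewrite cat_rcons (sorted_pairwise ltn_trans) pairwise_cat /=.
case/and3P=> hCx _ /andP[hxT _].
have := mem_rcons C x x; rewrite mem_head -(perm_mem (st_low st)) mem_filter.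
case/andP=> Sx xu; split=> // [y yu Sy|].
  move: (state_mem st Sy); rewrite yu mem_rcons inE => /esym/orP[/eqP->//|yC].
  by move/allrelP: hCx => /(_ y x yC (mem_head _ _)) /ltnW.
by case: T hxT {hT hCx st} => [|t T] /=; [lia | case/andP].
Qed.

Lemma S_h : ~~ S h.
Proof. by apply/negP => /S_lt; rewrite ltnn. Qed.

Lemma state_perm u u' T C Q : state u T C Q -> perm_eq u' u ->
  has_peaks S h (u' ++ T) h' -> ~~ S (last h u') -> state u' T C Q.
Proof.
case=> _ hC hQ hu _ hs hl hT hp pr hlast; split=> //.
- by apply: perm_trans hC; apply: perm_filter.
- by apply: perm_trans hQ; apply: perm_filter.
- by rewrite (perm_uniq hp).
Qed.

Lemma state_settle u x T C Q : state (rcons u x) T (rcons C x) Q ->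
  ~~ S (last h u) -> state u (x :: T) C Q.
Proof.
case=> pr hC hQ hu hx hs hl hT hlast.
rewrite last_rcons in hx; rewrite !cat_rcons in pr hs hl.
split=> //=; last by rewrite hx.
- by rewrite filter_rcons /= hx -!cats1 perm_cat2r in hC.
- by rewrite filter_rcons (negbTE hx) in hQ.
- by move: hu; rewrite rcons_uniq => /andP[].
Qed.

Lemma has_peaks_head u T : has_peaks S h (u ++ T) h' -> all (gtn h) u -> ~~ S (head h u).
Proof.
case: u => [_ _|y u] /=; first exact: S_h.
by case/andP=> /eqP-> _ /andP[yh _]; rewrite negb_and -leqNgt ltnW.
Qed.

Lemma state_all u T C Q : state u T C Q -> all (gtn h) u.
Proof.
move=> st; apply/allP => y yu /=; case Sy: (S y); first exact: S_lt.
have := st_lt st; rewrite all_cat => /andP[/allP hC _]; apply: hC.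
by rewrite -(state_mem st) ?Sy.
Qed.

(** * Settling the largest unsettled non-pinnacle *)

(** Reversing [x :: u2] puts [x] before [T], or before the border, which exceeds it. The former last
    entry is at most [x] and lands next to a pinnacle or the border, so the reversed bits of [u2]
    still follow a [true] and [surplus] stays the same. *)
Lemma settle_falling u1 x u2 T C Q K :
  state (u1 ++ x :: u2) T (rcons C x) Q -> x \notin K ->
  x < last h u1 -> u2 != [::] -> head 0 u2 < x ->
  exists u, [/\ reach 1 ((u1 ++ x :: u2) ++ T) (u ++ x :: T),
    state u (x :: T) C Q & surplus K u = surplus K (u1 ++ x :: u2)].
Proof.
move=> st xK hx u2n h2; have [Sx xu mx xT xh] := state_max st.
have uE : (u1 ++ rev (x :: u2)) ++ T = (u1 ++ rev u2) ++ x :: T.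
  by rewrite rev_cons -cats1 -!catA.
have Sy : ~~ S (last x u2) by have := st_last st; rewrite last_cat.
have yx : last x u2 <= x by apply: mx Sy; rewrite mem_cat mem_last orbT.
have yu2 : last 0 u2 = last x u2 by case: (u2) u2n.
have hp : has_peaks S h ((u1 ++ rev (x :: u2)) ++ T) h'.
  have := st_peaks st; rewrite -!catA => /has_peaks_reversal; apply=> //=.
  - by case: (u1) hx => [|a u1'] hx; [left | right; rewrite /compat; lia].
  - by rewrite /compat Sx; lia.
  - by rewrite /compat; lia.
  - by case: (T) xT => [|t T'] /= xT; [left | right; rewrite /compat; lia].
have st' : state (rcons (u1 ++ rev u2) x) T (rcons C x) Q.
  apply: state_perm st _ _ _; last by rewrite last_rcons.
    by rewrite -cats1 -catA perm_cat2l cats1 perm_rcons perm_cons perm_rev.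
  by rewrite -cats1 -catA cats1 -rev_cons.
exists (u1 ++ rev u2); split.
- by rewrite -uE -!catA; apply: reach1; rewrite catA.
- apply: state_settle st' _.
  have -> : last h (u1 ++ rev u2) = head 0 u2.
    by case: (u2) u2n => // y v _; rewrite rev_cons -rcons_cat last_rcons.
  have := st_peaks st; rewrite -catA has_peaks_cat /= => /and3P[_ _].
  case: (u2) u2n h2 => //= y v _ yx'; rewrite /peak_ok => /andP[/eqP-> _].
  by rewrite negb_and -leqNgt ltnW.
- have hb : last true (kbits K u1).
    have : ~~ (last h u1 <= x) by rewrite -ltnNge.
    case/lastP: (u1) mx => // v a mx; rewrite last_rcons => hax.
    have Sa : S a.
      by apply: contraNT hax; apply: mx; rewrite mem_cat mem_rcons mem_head.
    by rewrite /kbits filter_rcons Sa /= map_rcons last_rcons Sa.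
  rewrite /surplus kbits_cat adjF_cat hb kbits_cat adjF_cat hb kbits_rev adjF_rev.
  by rewrite /kbits /= (negbTE Sx) (negbTE xK).
Qed.

Lemma kbits_last K u : u = [::] \/ S (last 0 u) -> last true (kbits K u).
Proof.
case/lastP: u => // u y [/(congr1 size)|]; first by rewrite size_rcons.
by rewrite last_rcons /kbits filter_rcons => Sy; rewrite Sy map_rcons last_rcons.
Qed.

Lemma kbits_head K u : u = [::] \/ S (head 0 u) -> head true (kbits K u).
Proof. by case: u => // y u [//|/= Sy]; rewrite /kbits /= Sy. Qed.

Lemma last_gt_max u1 u T C x Q : state (u1 ++ u) T (rcons C x) Q ->
  x < last h u1 -> u1 = [::] \/ S (last 0 u1).
Proof.
move=> st; have [_ _ mx _ _] := state_max st.
case/lastP: u1 mx {st} => [|v a] mx; first by left.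
rewrite !last_rcons => hax; right; apply: contraLR hax => Sa.
by rewrite -leqNgt mx // mem_cat mem_rcons mem_head.
Qed.

Lemma head_gt_max u1 u2 T C x Q : state (u1 ++ u2) T (rcons C x) Q ->
  x < head h' u2 -> u2 = [::] \/ S (head 0 u2).
Proof.
move=> st; have [_ _ mx _ _] := state_max st.
case: u2 mx {st} => [|a v] mx; first by left.
move=> /= hax; right; apply: contraLR hax => Sa.
by rewrite -leqNgt mx // mem_cat mem_head orbT.
Qed.

(** Reversing the prefix that ends with [x] brings [x] next to [h], with its former left neighbour
    on its right. The former first entry is at most [x], hence below its new neighbour
    [head 0 u2]. *)
Lemma flip_rising u1 x u2 T C Q K :
  state (u1 ++ x :: u2) T (rcons C x) Q -> x \notin K ->
  u2 != [::] -> x < head h' u2 ->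
  exists u, [/\ u = x :: rev u1 ++ u2,
    reach 1 ((u1 ++ x :: u2) ++ T) (u ++ T),
    state u T (rcons C x) Q & surplus K u = surplus K (u1 ++ x :: u2)].
Proof.
move=> st xK u2n h2; have [Sx xu mx xT xh] := state_max st.
exists (x :: rev u1 ++ u2).
have uE : x :: rev u1 ++ u2 = [::] ++ rev (rcons u1 x) ++ u2 by rewrite rev_rcons.
have eqE : u1 ++ x :: u2 = [::] ++ rcons u1 x ++ u2 by rewrite cat_rcons.
have hd : ~~ S (head 0 (rcons u1 x)).
  have := has_peaks_head (st_peaks st) (state_all st).
  by case: (u1).
have hdx : head 0 (rcons u1 x) <= x.
  by apply: mx hd; rewrite -cat_rcons mem_cat; case: (u1) => [|? ?]; rewrite ?mem_head.
have hp : has_peaks S h ((x :: rev u1 ++ u2) ++ T) h'.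
  have := st_peaks st; rewrite uE eqE -!catA => /has_peaks_reversal; apply=> //=.
  - by case: (u1).
  - by left.
  - by rewrite /compat hd; case: (u2) u2n h2 => //= y v _; lia.
  - by rewrite last_rcons /compat Sx; lia.
  - by right; rewrite last_rcons; case: (u2) u2n h2 => //= y v _; rewrite /compat; lia.
split=> //.
- by rewrite eqE uE -!catA; apply: (@reach1 [::]); move: hp; rewrite uE -!catA.
- apply: (state_perm st _ hp).
    by rewrite eqE uE !cat0s perm_cat2r perm_rev.
  have := st_last st; rewrite last_cat /= last_cat.
  by case: (u2) u2n.
- have st' : state (rcons u1 x ++ u2) T (rcons C x) Q by rewrite cat_rcons.
  have hb := kbits_head K (head_gt_max st' h2).
  rewrite /surplus eqE uE !cat0s 2!kbits_cat 2!adjF_cat hb !andbF !addn0.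
  by rewrite kbits_rev adjF_rev.
Qed.

Lemma settle u1 x u2 T C Q K :
  state (u1 ++ x :: u2) T (rcons C x) Q -> x \notin K ->
  (last h u1 < x) || (head h' (u2 ++ T) < x) ->
  exists u, [/\ reach 2 ((u1 ++ x :: u2) ++ T) (u ++ x :: T),
    state u (x :: T) C Q & surplus K u = surplus K (u1 ++ x :: u2)].
Proof.
move=> st xK hx; have [Sx xu mx xT xh] := state_max st.
have : has_peaks S h (u1 ++ x :: u2 ++ T) h' by have := st_peaks st; rewrite -catA.
rewrite has_peaks_cat => /andP[pr1] /=; rewrite /peak_ok (negbTE Sx) => /andP[/eqP/esym hnp _].
have : uniq (rcons u1 x ++ u2) by rewrite cat_rcons (st_uniq st).
rewrite cat_uniq rcons_uniq => /and3P[/andP[xu1 _] hn un2].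
have {hn} xu2 : x \notin u2.
  by apply: contra hn => xu2; apply/hasP; exists x; rewrite // mem_rcons mem_head.
have ax : last h u1 != x.
  case/lastP: (u1) xu1 => [_|v a] /=; first by rewrite gtn_eqF.
  by rewrite last_rcons mem_rcons inE negb_or eq_sym => /andP[].
have [u2E|u2n] := eqVneq u2 [::].
  rewrite {}u2E /= in st hx *; rewrite [head _ _ < x]ltnNge (ltnW xT) orbF in hx.
  exists u1; split.
  - by rewrite -catA; apply: reach_refl.
  - rewrite cats1 in st; apply: state_settle st _; move: pr1 hx.
    case/lastP: (u1) => [_ _|v a]; first exact: S_h.
    rewrite last_rcons -cats1 has_peaks_cat /= andbT => /andP[_ /eqP->] hx.
    by rewrite negb_and -!leqNgt [_ <= x]ltnW ?orbT.
  - by rewrite /surplus kbits_cat /= /kbits /= (negbTE Sx) (negbTE xK) cats0.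
have hE : head h' (u2 ++ T) = head h' u2 by case: (u2) u2n.
have h0 : head 0 u2 = head h' u2 by case: (u2) u2n.
rewrite hE in hnp hx.
have [hax|hax] := ltnP x (last h u1).
  have zx : head 0 u2 < x by rewrite h0; move: hx; rewrite ltnNge (ltnW hax).
  have [u [r su su']] := settle_falling st xK hax u2n zx.
  by exists u; split=> //; apply: reach_le r.
(* Only the right neighbour exceeds [x]: after the flip the falling case applies with an empty left
   part. *)
have {ax} hax : last h u1 < x by rewrite ltn_neqAle ax.
have zx : x < head h' u2.
  rewrite ltnNge leq_eqVlt negb_or; move: hnp; rewrite hax /= => ->; rewrite andbT.
  by apply: contraNneq xu2 => <-; case: (u2) u2n => //= *; rewrite mem_head.
have [u [uE r1 st1 s1]] := flip_rising st xK u2n zx.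
have u1n : u1 != [::] by case: (u1) hax xh => //=; lia.
have hd : head 0 (rev u1 ++ u2) < x.
  by case/lastP: (u1) u1n hax => // v a _; rewrite rev_rcons last_rcons.
rewrite uE in st1 r1 s1.
have [|w [r2 st2 s2]] := @settle_falling [::] x _ T C Q K st1 xK xh _ hd.
  by case/lastP: (u1) u1n => // v a _; rewrite rev_rcons.
by exists w; split=> //; [apply: reach_trans r1 r2 | rewrite s2 s1].
Qed.

(** The stretch is cut between the non-peaks [last l A] and [head x B]. The former gets [x] as its
    neighbour and the latter [head r R], neither of which is smaller; [x] keeps [last x B] beside it
    and so stays a non-peak. *)
Lemma has_peaks_join l A B x R r : has_peaks S l (A ++ B ++ x :: R) r ->
  ~~ S x -> ~~ S (last l A) -> B != [::] -> ~~ S (head x B) ->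
  x <= last x B -> x < head r R -> last l A <= x -> head x B <= x ->
  has_peaks S l (A ++ x :: rev B ++ R) r.
Proof.
rewrite !has_peaks_cat /= => /and4P[hA hB hx hR] Sx Sw Bn Sz xa xz wx zx.
have BE d : head d (B ++ x :: R) = head x B by case: (B) Bn.
have -> : head r (rev B ++ R) = last x B.
  by case/lastP: (B) Bn => // v a _; rewrite rev_rcons last_rcons.
have hz : last x (rev B) = head x B.
  by case: (B) Bn => // a v _; rewrite rev_cons last_rcons.
have h0 : head 0 B = head x B by case: (B) Bn.
rewrite has_peaks_cat; apply/and4P; split.
- apply: has_peaks_compatr hA _; rewrite BE; case: (A) Sw wx => [|a v] Sw wx; first by left.
  by right; rewrite /compat /= in Sw wx *; rewrite Sw wx orbT.
- by rewrite /peak_ok (negbTE Sx) [last x B < x]ltnNge xa andbF.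
- rewrite has_peaks_rev; apply: has_peaks_compatl hB _; right.
  by rewrite h0 /compat Sz /=; lia.
- rewrite hz; apply: has_peaks_compatl hR _.
  by case: (R) xz => [|t v] /= xz; [left | right; rewrite /compat /=; lia].
Qed.

Lemma last_rev (T : Type) (d : T) s : last d (rev s) = head d s.
Proof. by case: s => // y s; rewrite rev_cons last_rcons. Qed.

Lemma head_rev (T : Type) (d : T) s : head d (rev s) = last d s.
Proof. by case/lastP: s => // s y; rewrite rev_rcons last_rcons. Qed.

Lemma has_peaks_join_right l R x B A r : has_peaks S l (R ++ x :: B ++ A) r ->
  ~~ S x -> ~~ S (head r A) -> B != [::] -> ~~ S (last x B) ->
  x <= head x B -> x < last l R -> head r A <= x -> last x B <= x ->
  has_peaks S l (R ++ rev B ++ x :: A) r.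
Proof.
have e1 : rev (R ++ x :: B ++ A) = rev A ++ rev B ++ x :: rev R.
  by rewrite rev_cat rev_cons rev_cat cat_rcons catA.
have e2 : rev (R ++ rev B ++ x :: A) = rev A ++ x :: rev (rev B) ++ rev R.
  by rewrite rev_cat rev_cat rev_cons cat_rcons -catA.
move=> hp Sx SA Bn SB hx hR hA hB.
rewrite -has_peaks_rev e1 in hp; rewrite -has_peaks_rev e2.
apply: has_peaks_join hp Sx _ _ _ _ _ _ _; rewrite ?last_rev ?head_rev //.
by case: (B) Bn => // a v _; rewrite rev_cons; case: (rev v).
Qed.

(** With one more small value than pinnacles, [adj_balance] equates [surplus] with the number of
    true-true pairs plus the last bit. As [x] leaves no bit, the pinnacles or borders around it form
    such a pair or make the last bit [true]. *)
Lemma surplus_gt0 u1 x u2 T K D Q :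
  state (u1 ++ x :: u2) T (K ++ D) Q -> uniq K -> size K = (size Q).+1 ->
  x \notin K -> ~~ S x ->
  last true (kbits K u1) -> u2 = [::] \/ S (head 0 u2) ->
  0 < surplus K (u1 ++ x :: u2).
Proof.
move=> st uK sK xK Sx hl hh2.
have b0 : kbits K (u1 ++ x :: u2) = kbits K u1 ++ kbits K u2.
  by rewrite kbits_cat {2}/kbits /= (negbTE Sx) (negbTE xK).
have nT : count id (kbits K (u1 ++ x :: u2)) = size Q.
  rewrite -(perm_size (st_high st)) size_filter /kbits count_map count_filter.
  by apply: eq_count => y /=; case: (S y).
have nF : count negb (kbits K (u1 ++ x :: u2)) = size K.
  have KS : {in K, forall y, ~~ S y}.
    move=> y yK; have := mem_cat y K D; rewrite yK -(perm_mem (st_low st)).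
    by rewrite mem_filter => /andP[].
  rewrite /kbits count_map count_filter -size_filter; apply: perm_size.
  apply: uniq_perm => //; first by rewrite filter_uniq ?(st_uniq st).
  move=> y; rewrite mem_filter /=; case Sy: (S y) => /=.
    by apply/esym/negP => /KS; rewrite Sy.
  rewrite (state_mem st) ?Sy // mem_cat.
  by case: (y \in K).
have := adj_balance true (kbits K (u1 ++ x :: u2)); rewrite nT nF sK -/(surplus _ _).
suff : 0 < adj true true (kbits K (u1 ++ x :: u2)) +
           last true (kbits K (u1 ++ x :: u2)) by lia.
rewrite b0 adj_cat last_cat hl.
case: hh2 => [->|]; first by rewrite addn1.
case: (u2) => [|y v] /= Sy; first by rewrite addn1.
have -> : kbits K (y :: v) = true :: kbits K v by rewrite /kbits /= Sy /= Sy.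
by rewrite /=; lia.
Qed.

(** A counted pair lies on one side of [x]. Reversing from the cut inside that pair up to [x] gives
    [x] a smaller neighbour. *)
Lemma join_singleton u1 x u2 T C Q K :
  state (u1 ++ x :: u2) T (rcons C x) Q -> x \notin K ->
  x < last h u1 -> x < head h' (u2 ++ T) -> 0 < surplus K (u1 ++ x :: u2) ->
  exists v1 v2, [/\ reach 1 ((u1 ++ x :: u2) ++ T) ((v1 ++ x :: v2) ++ T),
    state (v1 ++ x :: v2) T (rcons C x) Q,
    (last h v1 < x) || (head h' (v2 ++ T) < x) &
    (surplus K (v1 ++ x :: v2)).+1 = surplus K (u1 ++ x :: u2)].
Proof.
move=> st xK hx1 hx2; have [Sx xu mx xT xh] := state_max st.
have kx v : kbits K (x :: v) = kbits K v.
  by rewrite /kbits /= (negbTE Sx) (negbTE xK).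
have xn : x \notin u1 ++ u2.
  by have := st_uniq st; rewrite (uniq_catCA u1 [:: x] u2) => /andP[].
have mxl y : y \in u1 ++ u2 -> ~~ S y -> y < x.
  move=> yu Sy; rewrite ltn_neqAle mx // ?andbT.
    by apply: contraNneq xn => <-.
  by move: yu; rewrite !mem_cat inE => /orP[->|->]; rewrite ?orbT.
have s1 : u1 = [::] \/ S (last 0 u1) := last_gt_max st hx1.
have s2 : u2 = [::] \/ S (head 0 u2).
  have st' : state (rcons u1 x ++ u2) T (rcons C x) Q by rewrite cat_rcons.
  have [->|u2n] := eqVneq u2 [::]; first by left.
  by apply: (head_gt_max st'); case: (u2) u2n hx2.
have hb1 := kbits_last K s1; have hb2 := kbits_head K s2.
have -> : surplus K (u1 ++ x :: u2) = surplus K u1 + surplus K u2.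
  by rewrite /surplus kbits_cat kx adjF_cat hb1 addn0.
rewrite addn_gt0.
(* A pinnacle or border at the cut would yield the bit [true], so the entries on both sides of the
   cut exist and are non-pinnacles. *)
have dec A : last true (kbits K A) = false ->
    [/\ A != [::], ~~ S (last 0 A) & forall d, last d A = last 0 A].
  move=> hA; have An : A != [::] by apply: contraFneq hA => ->.
  split=> // [|d]; last by case: (A) An.
  by apply/negP => SA; rewrite kbits_last in hA => //; right.
have dec' A : head true (kbits K A) = false ->
    [/\ A != [::], ~~ S (head 0 A) & forall d, head d A = head 0 A].
  move=> hA; have An : A != [::] by apply: contraFneq hA => ->.
  split=> // [|d]; last by case: (A) An.
  by apply/negP => SA; rewrite kbits_head in hA => //; right.
case/orP=> /cut_between_small[A [B [uE hA hB]]].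
  have [An SA dA] := dec A hA; have [Bn SB dB] := dec' B hB.
  have Ax : last 0 A < x.
    apply: mxl SA; rewrite uE -catA mem_cat; case/lastP: (A) An => // v a _.
    by rewrite last_rcons mem_rcons mem_head.
  have Bx : head 0 B < x.
    apply: mxl SB; rewrite uE -catA !mem_cat; case: (B) Bn => // b v _.
    by rewrite mem_head orbT.
  have xB : x <= last x B.
    by move: hx1; rewrite uE last_cat; case: (B) Bn => // b v _ /ltnW.
  have hp : has_peaks S h ((A ++ x :: rev B ++ u2) ++ T) h'.
    rewrite -catA /= -catA; apply: has_peaks_join => //; rewrite ?dA ?dB //; last exact: ltnW.
      by have := st_peaks st; rewrite uE -!catA.
    exact: ltnW.
  have eqE : u1 ++ x :: u2 = A ++ rcons B x ++ u2 by rewrite uE cat_rcons -catA.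
  have eqE' : A ++ x :: rev B ++ u2 = A ++ rev (rcons B x) ++ u2 by rewrite rev_rcons.
  exists A, (rev B ++ u2); split.
  - by rewrite eqE eqE' -!catA; apply: reach1; move: hp; rewrite eqE' -!catA.
  - apply: (state_perm st _ hp).
      by rewrite eqE eqE' perm_cat2l perm_cat2r perm_rev.
    have := st_last st; rewrite !last_cat /= last_cat; case: (u2) => [|? ?] //= _.
    by rewrite last_rev (dB x).
  - by rewrite dA Ax.
  (* After the reversal every junction has a [true] on one side, so exactly the pair that was cut is
     lost. *)
  - have lB : last true (kbits K B).
      by move: hb1 hB; rewrite uE kbits_cat last_cat; case: (kbits K B).
    have hr : head true (rev (kbits K B) ++ kbits K u2).
      by move: lB hb2; rewrite -head_rev; case: (rev _).
    rewrite uE /surplus 2!kbits_cat kx kbits_cat kbits_rev !adjF_cat adjF_rev.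
    by rewrite hA hB hb2 hr /= andbF /= !addn0 addn1 addSn addnA.
(* The mirror image: the pair lies in [u2], and [x :: A] is reversed. *)
have [An SA dA] := dec A hA; have [Bn SB dB] := dec' B hB.
have Ax : last 0 A < x.
  apply: mxl SA; rewrite uE !mem_cat; case/lastP: (A) An => // v a _.
  by rewrite last_rcons mem_rcons mem_head orbT.
have Bx : head 0 B < x.
  apply: mxl SB; rewrite uE !mem_cat; case: (B) Bn => // b v _.
  by rewrite mem_head !orbT.
have xA : x <= head x A.
  by move: hx2; rewrite uE; case: (A) An => // b v _ /ltnW.
have dBT : head h' (B ++ T) = head 0 B by case: (B) Bn.
have hp : has_peaks S h ((u1 ++ rev A ++ x :: B) ++ T) h'.
  rewrite -!catA; apply: has_peaks_join_right => //; rewrite ?dA ?dBT //; try exact: ltnW.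
  by have := st_peaks st; rewrite uE -!catA /= -!catA.
have eqE : u1 ++ x :: u2 = u1 ++ (x :: A) ++ B by rewrite uE.
have eqE' : u1 ++ rev A ++ x :: B = u1 ++ rev (x :: A) ++ B.
  by rewrite rev_cons cat_rcons.
exists (u1 ++ rev A), B; rewrite -(catA u1 (rev A)); split.
- by rewrite eqE eqE' -!catA; apply: reach1; move: hp; rewrite eqE' -!catA.
- apply: (state_perm st _ hp).
    by rewrite eqE eqE' perm_cat2l perm_cat2r perm_rev.
  have := st_last st; rewrite uE !last_cat /= last_cat.
  by case: (B) Bn.
- by rewrite dBT Bx orbT.
- have hA' : head true (kbits K A).
    by move: hb2 hA; rewrite uE kbits_cat; case: (kbits K A).
  rewrite uE /surplus !kbits_cat kx kbits_rev !adjF_cat adjF_rev last_rev.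
  by rewrite hA hB hb1 hA' /= !addn0 addn1 addnS.
Qed.

(** An amortized bound: two reversals are charged to [x], and a third one, for joining, is paid for
    by the drop of [surplus]. *)
Lemma settle_max u T C x Q K : state u T (rcons C x) Q -> x \notin K ->
  prefix K (rcons C x) -> size K = (size Q).+1 ->
  exists v, [/\ reach (2 + (surplus K u - surplus K v)) (u ++ T) (v ++ x :: T),
    state v (x :: T) C Q & surplus K v <= surplus K u].
Proof.
move=> st xK /prefixP[D eC] sK; have [Sx xu mx xT xh] := state_max st.
have [u1 [u2 uE]] : exists u1 u2, u = u1 ++ x :: u2.
  by case/splitPr: xu => u1 u2; exists u1, u2.
rewrite {}uE in st mx *.
have [hnb|] := boolP ((last h u1 < x) || (head h' (u2 ++ T) < x)).
  have [u' [r st' e]] := settle st xK hnb.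
  by exists u'; rewrite e; split=> //; apply: reach_le r; apply: leq_addr.
have xn : x \notin u1 ++ u2.
  by have := st_uniq st; rewrite (uniq_catCA u1 [:: x] u2) => /andP[].
rewrite negb_or -!leqNgt => /andP[hx1 hx2].
have {}hx1 : x < last h u1.
  rewrite ltn_neqAle hx1 andbT; case/lastP: (u1) xn => [_|v a]; first by rewrite ltn_eqF.
  rewrite last_rcons; apply: contraNneq => ->.
  by rewrite mem_cat mem_rcons mem_head.
have {}hx2 : x < head h' (u2 ++ T).
  rewrite ltn_neqAle hx2 andbT; case: (u2) xn => [_|a v] /=; first by rewrite ltn_eqF.
  by apply: contraNneq => ->; rewrite mem_cat mem_head orbT.
have sp : 0 < surplus K (u1 ++ x :: u2).
  have st' : state (rcons u1 x ++ u2) T (rcons C x) Q by rewrite cat_rcons.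
  have uC : uniq (rcons C x).
    by rewrite -(perm_uniq (st_low st)) filter_uniq ?(st_uniq st).
  have st2 := st; rewrite eC in st2 uC; apply: (surplus_gt0 st2 _ sK xK Sx).
  - by move: uC; rewrite cat_uniq => /andP[].
  - by apply/kbits_last/(last_gt_max st hx1).
  - have [->|u2n] := eqVneq u2 [::]; first by left.
    by apply: (head_gt_max st'); case: (u2) u2n hx2.
have [v1 [v2 [r1 st1 hn s1]]] := join_singleton st xK hx1 hx2 sp.
have [v [r2 st2 s2]] := settle st1 xK hn.
exists v; rewrite -s1 s2; split=> //.
by rewrite subSnn addn1 -(add1n 2); apply: reach_trans r1 r2.
Qed.

Lemma settle_all K D u T Q : state u T (K ++ D) Q -> size K = (size Q).+1 ->
  exists v, reach (2 * size D + surplus K u) (u ++ T) (v ++ D ++ T) /\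
    state v (D ++ T) K Q.
Proof.
elim/last_ind: D u T => [|D x IH] u T st sK.
  by exists u; split; [apply: reach_refl | rewrite cats0 in st].
have uC : uniq (K ++ rcons D x).
  by rewrite -(perm_uniq (st_low st)) filter_uniq ?(st_uniq st).
have xK : x \notin K.
  move: uC; rewrite cat_uniq => /and3P[_ /hasPn/(_ x) h1 _]; apply: h1.
  by rewrite mem_rcons mem_head.
rewrite -rcons_cat in st.
have [|v [r1 st1 s1]] := settle_max st xK _ sK.
  by apply/prefixP; exists (rcons D x); rewrite rcons_cat.
have [w [r2 st2]] := IH _ _ st1 sK.
exists w; rewrite cat_rcons; split=> //.
apply: reach_le (reach_trans r1 r2); rewrite size_rcons; lia.
Qed.

(** * Alternating words *)

Lemma has_peaks_adj l u r : has_peaks S l u r -> adj true false (map S u) = 0.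
Proof.
elim: u l => //= a [|b v] IH l //= /andP[ha hv]; have := IH _ hv; rewrite /= !add0n => ->.
case/andP: hv => hb _; move: ha hb; rewrite /peak_ok.
by do 2!case: (S _) => //=; lia.
Qed.

Lemma has_peaks_next l A y z B r : has_peaks S l (A ++ y :: z :: B) r ->
  (S y -> ~~ S z /\ z < y) /\ (S z -> ~~ S y /\ y < z).
Proof.
rewrite has_peaks_cat /= => /and4P[_ /eqP Sy /eqP Sz _].
by move: Sy Sz; case: (S y); case: (S z) => /=; split=> // _; lia.
Qed.

(** No two peaks are adjacent, so [adj_balance] only retains the pairs of non-peaks; the extra one
    is due to the non-peaks at both ends. *)
Lemma has_peaks_count l u r : has_peaks S l u r -> u != [::] ->
  ~~ S (head 0 u) -> ~~ S (last 0 u) ->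
  count (predC S) u = (adj false true (map S u) + count S u).+1.
Proof.
move=> hp un hd hl; have noSS : adj true true (map S u) = 0.
  by have := has_peaks_adj hp; case: (u) hd => //= a v; case: (S a).
have := adj_balance true (map S u); rewrite noSS !count_map.
have -> : last true (map S u) = false.
  by case/lastP: (u) un hl => // v a _; rewrite map_rcons !last_rcons => /negbTE.
have -> : count (preim S negb) u = count (predC S) u by apply: eq_count.
have -> : count (preim S id) u = count S u by apply: eq_count.
by rewrite add0n !addn0 addn1.
Qed.

(** With one non-peak more than peaks, the count leaves no room for two adjacent non-peaks. *)
Lemma has_peaks_alternates l u r A y z B :
  has_peaks S l u r -> u = A ++ y :: z :: B ->
  ~~ S (head 0 u) -> ~~ S (last 0 u) ->
  count (predC S) u = (count S u).+1 -> ~~ S y -> S z.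
Proof.
move=> hp uE hd hl hc Sy; apply: contraT => Sz.
have un : u != [::] by rewrite uE; case: (A).
have := has_peaks_count hp un hd hl; rewrite hc uE map_cat adj_cat /=.
by rewrite (negbTE Sy) (negbTE Sz) /=; lia.
Qed.

Lemma state_gap u T C Q y : state u T C Q -> y \in C -> y < head h' T /\ y < h.
Proof.
move=> st yC; have := st_sorted st; have := st_lt st; rewrite all_cat.
case/andP=> /allP/(_ y yC)/= yh _; rewrite (sorted_pairwise ltn_trans) pairwise_cat.
case/and3P=> /allrelP hCT _ _; split=> //.
by case: (T) hCT => [_|t v hCT] /=; [lia | apply: hCT; rewrite ?mem_head].
Qed.

Lemma state_count u T C Q : state u T C Q -> 
  count (predC S) u = size C /\ count S u = size Q.
Proof.
by case=> _ hC hQ *; rewrite -(perm_size hC) -(perm_size hQ) !size_filter.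
Qed.

(** * Bringing the smallest value to the front *)

(** Each reversal makes the first entry smaller, so its rank in [c :: C] bounds the number of
    reversals. *)
Lemma bring_min_to_front c C Q u T : state u T (c :: C) Q -> size C = size Q ->
  exists u', reach (index (head 0 u) (c :: C)) (u ++ T) ((c :: u') ++ T) /\
    state (c :: u') T (c :: C) Q.
Proof.
move=> st sC; move eqk: (index _ _) => k; elim/ltn_ind: k u st eqk => k IH u st eqk.
have srt : sorted ltn (c :: C).
  by have := st_sorted st; rewrite !(sorted_pairwise ltn_trans) pairwise_cat => /and3P[].
have Sc : ~~ S c.
  by have := mem_head c C; rewrite -(perm_mem (st_low st)) mem_filter => /andP[].
have cu : c \in u by rewrite (state_mem st Sc) mem_head.
have h0 x : head x u = head 0 u by case: (u) cu.
have l0 x : last x u = last 0 u by case: (u) cu.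
have [du lu] : head 0 u \in u /\ last 0 u \in u.
  by case: (u) cu => // y v _ /=; rewrite mem_head mem_last.
have Sd : ~~ S (head 0 u).
  by rewrite -(h0 h); apply: has_peaks_head (st_peaks st) (state_all st).
have Sl : ~~ S (last 0 u) by rewrite -(l0 h); apply: st_last st.
have dC : head 0 u \in c :: C by rewrite -(state_mem st Sd).
have [dc|dc] := eqVneq (head 0 u) c.
  exists (behead u); have -> : c :: behead u = u by rewrite -dc; case: (u) cu.
  by split=> //; apply: reach_refl.
have cd : c < head 0 u.
  move: dC; rewrite inE (negbTE dc) /=; move: srt.
  by rewrite /= (path_sortedE ltn_trans) => /andP[/allP h1 _] /h1.
have alt A y z B : u = A ++ y :: z :: B -> ~~ S y -> S z.
  move=> uE; have := st_peaks st; rewrite has_peaks_cat => /andP[hp _].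
  apply: (has_peaks_alternates hp uE Sd Sl).
  by have [-> ->] := state_count st; rewrite /= sC.
have [u1 [u2 uE]] : exists u1 u2, u = u1 ++ c :: u2.
  by case/splitPr: cu => u1 u2; exists u1, u2.
(* The cut comes before the first pinnacle after [c] that exceeds the first entry. If there is none,
   [find] returns the length of [u2] and the whole unsettled part is reversed. *)
pose q y := S y && (head 0 u < y); pose i := find q u2.
pose v1 := take i u2; pose v2 := drop i u2.
have u2E : u2 = v1 ++ v2 by rewrite cat_take_drop.
have hv1 y : y \in v1 -> S y -> y <= head 0 u.
  move=> yv Sy; rewrite leqNgt; have : ~~ has q v1.
    by rewrite /v1 has_take_leq ?find_size // ltnn.
  by move=> /hasPn/(_ y yv); rewrite /q Sy.
have hv2 : v2 = [::] \/ q (head 0 v2).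
  have [hq|hq] := boolP (has q u2).
    by right; rewrite /v2 -nth0 nth_drop addn0 nth_find.
  by left; apply: drop_oversize; rewrite /i hasNfind.
have u1n : u1 != [::] by apply: contraNneq dc => u10; rewrite uE u10.
(* [e] precedes the cut and becomes the new first entry. Either it is [c], or it lies below the
   pinnacle before it, which by the choice of the cut is at most [head 0 u]. *)
pose e := last c v1.
have [Se ed] : ~~ S e /\ e < head 0 u.
  have [v10|[v [a Ev1]]] : v1 = [::] \/ exists v a, v1 = rcons v a.
    by case/lastP: (v1) => [|v a]; [left | right; exists v, a].
    by rewrite /e v10.
  rewrite /e Ev1 last_rcons.
  have Sa : ~~ S a.
    case: hv2 => [v20|]; first by move: Sl; rewrite uE last_cat /= u2E v20 cats0 Ev1 last_rcons.
    case Ev2 : v2 => [|z v3] /=; first by rewrite /q ltn0 andbF.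
    case/andP=> Sz _.
    have := st_peaks st; rewrite uE u2E Ev1 Ev2.
    have -> : (u1 ++ c :: rcons v a ++ z :: v3) ++ T = (u1 ++ c :: v) ++ a :: z :: (v3 ++ T).
      by rewrite -!catA /= cat_rcons -catA.
    by case/has_peaks_next => _ /(_ Sz) [].
  have {}uE : u = (u1 ++ belast c v) ++ last c v :: a :: v2.
    by rewrite uE u2E Ev1 cat_rcons -cat_cons lastI cat_rcons catA.
  have Sy : S (last c v).
    by apply: contraT => /(alt _ _ _ _ uE); rewrite (negbTE Sa).
  have := st_peaks st; rewrite {1}uE -catA => /has_peaks_next[/(_ Sy)[_ ay] _].
  split=> //; apply: leq_trans ay _; apply: hv1 => //.
  rewrite Ev1 mem_rcons inE; case: (v) Sy => [|b w]; first by rewrite (negbTE Sc).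
  by rewrite /= mem_last orbT.
have eu : e \in u.
  rewrite uE u2E mem_cat -cat_cons mem_cat /e; case: (v1) => [|b w] /=.
    by rewrite mem_head orbT.
  by rewrite in_cons mem_last !orbT.
have eC : e \in c :: C by rewrite -(state_mem st Se).
have [dT dh] := state_gap st dC; have [eT eh] := state_gap st eC.
have [B BE] : exists B, B = u1 ++ c :: v1 by exists (u1 ++ c :: v1).
have uE2 : u = [::] ++ B ++ v2 by rewrite uE u2E BE -catA.
have Bn : B != [::] by rewrite BE; case: (u1).
have hB : head 0 B = head 0 u by rewrite uE2; case: (B) Bn.
have lB : last 0 B = e by rewrite BE last_cat.
have dz : head 0 u < head h' (v2 ++ T).
  case: hv2 => [->//|]; case: (v2) => [|z v3] /=; last by case/andP.
  by rewrite /q ltn0 andbF.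
have hp : has_peaks S h ((rev B ++ v2) ++ T) h'.
  have := st_peaks st; rewrite {1}uE2 -!catA => /has_peaks_reversal; rewrite hB lB; apply=> //.
  - by left.
  - by apply: compat_le => //; apply: ltnW.
  - by apply: compat_le => //; apply: ltnW.
  - by right; apply: compat_gt; rewrite // (ltn_trans ed).
have st' : state (rev B ++ v2) T (c :: C) Q.
  apply: (state_perm st _ hp); first by rewrite uE2 perm_cat2r perm_rev.
  case: hv2 => [->|]; first by rewrite cats0 last_rev; case: (B) hB Bn => //= a w ->.
  case Ev2: v2 => [|z v3] /=; first by rewrite /q ltn0 andbF.
  by move: Sl; rewrite uE2 Ev2 !last_cat.
have he : head 0 (rev B ++ v2) = e.
  by rewrite -lB -head_rev; case/lastP: (B) Bn => // v a _; rewrite rev_rcons.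
have ik : index e (c :: C) < k.
  rewrite -eqk ltnNge leq_eqVlt; apply/negP => /orP[/eqP E|].
    by move: ed; rewrite -(nth_index 0 dC) E nth_index // ltnn.
  move=> /(sorted_ltn_index ltn_trans srt _ _ dC eC) de.
  by have := ltn_trans ed de; rewrite ltnn.
have [|u' [r st'']] := IH _ ik _ st'; first by rewrite he.
have r1 : reach 1 (u ++ T) ((rev B ++ v2) ++ T).
  by rewrite uE2 -!catA; apply: (@reach1 [::]); move: hp; rewrite -!catA.
by exists u'; split=> //; apply: reach_le (reach_trans r1 r).
Qed.

(** * The final order *)

(** The list counterpart of [canonical]. Since the rest of [cs] is kept, the settled entries can be
    appended to it. *)
Fixpoint weave (cs ss : seq nat) : seq nat :=
  if ss is s :: ss' then head 0 cs :: s :: weave (behead cs) ss' else cs.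

Lemma sorted_head_le (s : seq nat) a y : sorted ltn (a :: s) -> y \in a :: s -> a <= y.
Proof.
rewrite /= (path_sortedE ltn_trans) inE => /andP[/allP ha _] /orP[/eqP->//|/ha].
exact: ltnW.
Qed.

(** Each round places the least remaining pinnacle and then the least remaining non-pinnacle after
    [c], with one reversal each. The last round is free, whence the predecessor in the bound. *)
Lemma sort_alternating ss cs pre c u T :
  has_peaks S h (pre ++ (c :: u) ++ T) h' ->
  perm_eq (filter (predC S) u) cs -> perm_eq (filter S u) ss ->
  size cs = size ss -> ~~ S c -> ~~ S (last c u) ->
  sorted ltn (c :: cs) -> sorted ltn ss -> all (gtn (head h' T)) cs ->
  reach (2 * (size ss).-1) (pre ++ (c :: u) ++ T) (pre ++ weave (c :: cs ++ T) ss).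
Proof.
elim: ss cs pre c u => [|s ss IH] cs pre c u hp pC pS sz Sc Sl srtC srtS cT.
  case: cs sz pC {srtC cT} => // _ /perm_nilP pC.
  have -> : u = [::].
    case: (u) pC pS => // a v /=; case: (S a) => //= _.
    by move/perm_nilP.
  exact: reach_refl.
have mC y : ~~ S y -> (y \in u) = (y \in cs).
  by move=> Sy; rewrite -(perm_mem pC) mem_filter /= Sy.
have mS y : S y -> (y \in u) = (y \in s :: ss).
  by move=> Sy; rewrite -(perm_mem pS) mem_filter /= Sy.
have cC : count (predC S) u = (size ss).+1 by rewrite -size_filter (perm_size pC).
have cS : count S u = (size ss).+1 by rewrite -size_filter (perm_size pS).
have alt A y z B : c :: u = A ++ y :: z :: B -> ~~ S y -> S z.
  move=> uE; have := hp; rewrite !has_peaks_cat => /and3P[_ hp' _].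
  apply: (has_peaks_alternates hp' uE) => //; by rewrite /= (negbTE Sc) cC cS.
have Ss : S s.
  by have := mem_head s ss; rewrite -(perm_mem pS) mem_filter => /andP[].
have su : s \in u by rewrite mS ?mem_head.
have SP : S (head 0 u).
  by case: (u) su alt => // a v _ /(_ [::] c a v erefl Sc).
case: cs sz pC mC cC srtC cT => // c2 cs [sz] pC mC cC srtC cT.
(* One pinnacle and one non-pinnacle remain, and alternation already puts the pinnacle after [c]. *)
have [ss0|ssn] := eqVneq ss [::].
  rewrite ss0 in pS cS cC sz *; case: cs sz pC {mC srtC cT} => // _ pC.
  have : size u = 2 by rewrite -(count_predC S) cS cC.
  case: (u) SP Sl pC pS => [|a [|b []]] //= Sa Sb.
  rewrite Sa (negbTE Sb) /= => pC pS _.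
  have := perm_mem pC b; rewrite !inE eqxx => /esym/eqP ->.
  have := perm_mem pS a; rewrite !inE eqxx => /esym/eqP ->.
  exact: reach_refl.
have [u1 [u2 uE]] : exists u1 u2, u = u1 ++ s :: u2.
  by case/splitPr: su => u1 u2; exists u1, u2.
have u2n : u2 != [::].
  by apply: contraNneq Sl => u20; rewrite uE u20 last_cat.
have d2 x v : head x (u2 ++ v) = head 0 u2 by case: (u2) u2n.
have [Sd ds] : ~~ S (head 0 u2) /\ head 0 u2 < s.
  case: (u2) u2n uE => // d v _ uE.
  have : has_peaks S h ((pre ++ c :: u1) ++ s :: d :: (v ++ T)) h'.
    by have := hp; rewrite uE -!catA /= -!catA.
  by case/has_peaks_next => /(_ Ss).
have sle y : y \in u -> S y -> s <= y.
  by move=> yu Sy; apply: sorted_head_le srtS _; rewrite -mS.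
have clt y : y \in u -> ~~ S y -> c < y.
  move=> yu Sy; have := srtC; rewrite /= => /andP[h1 h2].
  by apply: leq_trans h1 _; apply: sorted_head_le h2 _; rewrite -mC.
have du : head 0 u2 \in u.
  by rewrite uE; case: (u2) u2n => // ? ? _; rewrite mem_cat !inE eqxx !orbT.
have cs' : c < s by apply: ltn_trans ds; apply: clt.
have Pu : head 0 u \in u by case: (u) su => // *; rewrite mem_head.
have sP := sle _ Pu SP.
(* First reversal: [s] moves next to [c]. The displaced pinnacle [head 0 u] is at least [s], which
   exceeds its new neighbour [head 0 u2]. *)
have e1 : pre ++ (c :: u) ++ T = (pre ++ [:: c]) ++ rcons u1 s ++ (u2 ++ T).
  by rewrite uE cat_rcons -!catA /= -!catA.
have hB : head 0 (rcons u1 s) = head 0 u by rewrite uE; case: (u1).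
have hp1 : has_peaks S h ((pre ++ [:: c]) ++ rev (rcons u1 s) ++ (u2 ++ T)) h'.
  move: hp; rewrite e1 => /has_peaks_reversal; rewrite hB last_rcons last_cat /= d2; apply.
  - by case: (u1).
  - right; apply: compat_le => //; exact: ltnW.
  - by apply: compat_gt; apply: leq_trans sP.
  - exact: compat_gt.
  - right; apply: compat_le => //; apply: ltnW; exact: leq_trans sP.
have r1 := reach1 hp1; rewrite -e1 in r1.
have [u' u'E] : exists v, v = rev u1 ++ u2 by exists (rev u1 ++ u2).
have e2 : (pre ++ [:: c]) ++ rev (rcons u1 s) ++ u2 ++ T = (pre ++ [:: c; s]) ++ u' ++ T.
  by rewrite rev_rcons u'E -!catA.
rewrite e2 in r1 hp1.
have pu : perm_eq u (s :: u').
  by rewrite uE u'E -cat_rcons -cat_cons -rev_rcons perm_cat2r perm_sym perm_rev.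
have pC' : perm_eq (filter (predC S) u') (c2 :: cs).
  have := perm_filter (predC S) pu; rewrite /= Ss perm_sym => h1.
  by apply: perm_trans h1 pC.
have pS' : perm_eq (filter S u') ss.
  have := perm_filter S pu; rewrite /= Ss perm_sym => h1.
  by have := perm_trans h1 pS; rewrite perm_cons.
have Sl' x : ~~ S (last x u').
  by move: Sl; rewrite uE u'E !last_cat; case: (u2) u2n.
have u'n : u' != [::] by rewrite u'E; case: (rev u1).
have u'u y : y \in u' -> y \in u by move=> yu; rewrite (perm_mem pu) inE yu orbT.
have hdu : head 0 u' \in u' by case: (u') u'n => // *; rewrite mem_head.
have [Sd' ds'] : ~~ S (head 0 u') /\ head 0 u' < s.
  case: (u') u'n hp1 => // d v _ hp1.
  have : has_peaks S h ((pre ++ [:: c]) ++ s :: d :: (v ++ T)) h'.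
    by move: hp1; rewrite -!catA.
  by case/has_peaks_next => /(_ Ss).
have Sc2 : ~~ S c2.
  by have := mem_head c2 cs; rewrite -(perm_mem pC) mem_filter => /andP[].
have c2u : c2 \in u'.
  by have := mem_head c2 cs; rewrite -(perm_mem pC') mem_filter => /andP[].
have c2le y : y \in u' -> ~~ S y -> c2 <= y.
  move=> yu Sy; have := srtC; rewrite /= => /andP[_ h2].
  by apply: sorted_head_le h2 _; rewrite -mC // u'u.
have alt' A y z B : u' = A ++ y :: z :: B -> ~~ S y -> S z.
  move=> uE'; have := hp1; rewrite !has_peaks_cat => /and3P[_ hp' _].
  apply: (has_peaks_alternates hp' uE') => //.
  by rewrite -!size_filter (perm_size pC') (perm_size pS') /= sz.
have [w1 [w2 wE]] : exists w1 w2, u' = w1 ++ c2 :: w2.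
  by case/splitPr: c2u => w1 w2; exists w1, w2.
(* Second reversal: [c2] moves next to [s]. The displaced non-pinnacle [head 0 u'] meets a larger
   entry: a pinnacle, the beginning of [T] or the border. *)
have e3 : (pre ++ [:: c; s]) ++ u' ++ T = (pre ++ [:: c; s]) ++ rcons w1 c2 ++ w2 ++ T.
  by rewrite wE cat_rcons -!catA.
have hB' : head 0 (rcons w1 c2) = head 0 u' by rewrite wE; case: (w1).
have dz : head 0 u' < head h' (w2 ++ T).
  case: (w2) wE => [|z w3] /= wE.
    by have := allP cT (head 0 u'); rewrite -mC // u'u // => /(_ isT).
  have Sz := alt' _ _ _ _ wE Sc2; apply: leq_trans ds' _; apply: sle => //.
  by apply: u'u; rewrite wE mem_cat !inE eqxx !orbT.
have c2d := c2le _ hdu Sd'.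
have hp2 : has_peaks S h ((pre ++ [:: c; s]) ++ rev (rcons w1 c2) ++ w2 ++ T) h'.
  move: hp1; rewrite e3 => /has_peaks_reversal; rewrite hB' last_rcons last_cat /=; apply.
  - by case: (w1).
  - by right; apply: compat_gt => //; apply: leq_ltn_trans ds'.
  - by apply: compat_le => //; apply: ltnW.
  - by apply: compat_le => //; apply: ltnW; apply: leq_ltn_trans ds'.
  - by right; apply: compat_gt => //; apply: leq_ltn_trans dz.
have r2 := reach1 hp2; rewrite -e3 in r2.
have e4 : (pre ++ [:: c; s]) ++ rev (rcons w1 c2) ++ w2 ++ T =
          (pre ++ [:: c; s]) ++ (c2 :: (rev w1 ++ w2)) ++ T.
  by rewrite rev_rcons /= -!catA.
rewrite e4 in r2 hp2.
have pw : perm_eq u' (c2 :: (rev w1 ++ w2)).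
  by rewrite wE -cat_rcons -cat_cons -rev_rcons perm_cat2r perm_sym perm_rev.
have := IH cs _ c2 _ hp2; rewrite -[X in reach _ _ X]catA => IH'.
apply: reach_le (reach_trans (reach_trans r1 r2) (IH' _ _ sz Sc2 _ _ _ _)).
- by case: (ss) ssn => //= a v _; rewrite mulnS.
- have := perm_filter (predC S) pw; rewrite /= Sc2 perm_sym => h1.
  by have := perm_trans h1 pC'; rewrite perm_cons.
- have := perm_filter S pw; rewrite /= (negbTE Sc2) perm_sym => h1.
  by apply: perm_trans h1 pS'.
- move: (Sl' 0) Sd'; rewrite wE !last_cat /= last_rev.
  by case: (w2) => [|? ?] //= _; case: (w1).
- by move: srtC => /andP[].
- by apply: path_sorted srtS.
- by case/andP: cT.
Qed.

(** * The total number of reversals on words *)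

(** Distinct counted pairs end in distinct small values. *)
Lemma surplus_le K u : uniq u -> surplus K u <= size K.
Proof.
move=> uu; apply: (@leq_trans (count negb (kbits K u))).
  rewrite /surplus; elim: (kbits K u) true => //= y b IH p.
  by have := IH y; case: y; case: p => /=; lia.
rewrite /kbits count_map count_filter -size_filter; apply: uniq_leq_size.
  exact: filter_uniq.
by move=> y; rewrite mem_filter /=; case: (S y) => //= /andP[].
Qed.

(** The summands pay, in this order, for settling the values that are not small, for the drops of
    [surplus], for bringing the minimum to the front and for the final order. *)
Lemma sort_word w C Q :
  has_peaks S h w h' -> w != [::] -> uniq w -> sorted ltn C -> all (gtn h) C ->
  sorted ltn Q -> perm_eq (filter (predC S) w) C -> perm_eq (filter S w) Q ->
  size Q < size C /\
  reach (2 * (size C - (size Q).+1) + (size Q).+1 + (size Q + 2 * (size Q).-1))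
        w (weave C Q).
Proof.
move=> hp wn uw srtC hC srtQ pC pQ.
(* The right border is at least [h], which exceeds every pinnacle, so no pinnacle comes last. *)
have Sl : ~~ S (last h w).
  case/lastP: w wn hp {uw pC pQ} => // v a _.
  rewrite -cats1 has_peaks_cat last_cat /= => /andP[_ /andP[/eqP Sa _]].
  apply/negP => hS; have := S_lt hS; move: hS; rewrite Sa => /andP[_].
  by move=> /(leq_ltn_trans hh) /ltn_trans h1 /h1; rewrite ltnn.
have st : state w [::] C Q by split; rewrite ?cats0.
have [cC cQ] := state_count st.
have Sd : ~~ S (head h w) by apply: (has_peaks_head (st_peaks st)); apply: state_all st.
have sz : size Q < size C.
  rewrite -cC -cQ (has_peaks_count hp wn) ?ltnS ?leq_addl //.
    by case: (w) wn Sd.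
  by case: (w) wn Sl.
split=> //.
pose K := take (size Q).+1 C; pose D := drop (size Q).+1 C.
have CE : C = K ++ D by rewrite cat_take_drop.
have sK : size K = (size Q).+1 by rewrite size_takel.
have st0 : state w [::] (K ++ D) Q by rewrite -CE.
have [v [r1 st1]] := settle_all st0 sK.
case EK : K sK => [|c K'] //= [sK'].
rewrite EK in st1.
have [u' [r2 st2]] := bring_min_to_front st1 sK'.
rewrite !cats0 in r1 r2 st1 st2.
have Sc : ~~ S c.
  by have := mem_head c K'; rewrite -(perm_mem (st_low st2)) mem_filter => /andP[].
have /and3P[cT srtK _] : [&& allrel ltn (c :: K') D, sorted ltn (c :: K') & sorted ltn D].
  by rewrite !(sorted_pairwise ltn_trans) -pairwise_cat -(sorted_pairwise ltn_trans) -EK -CE.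
have r3 : reach (2 * (size Q).-1) ([::] ++ (c :: u') ++ D) ([::] ++ weave (c :: K' ++ D) Q).
  apply: sort_alternating => //.
  - exact: (st_peaks st2).
  - by have := st_low st2; rewrite /= Sc perm_cons.
  - by have := st_high st2; rewrite /= (negbTE Sc).
  - exact: (st_last st2).
  - apply/allP => y yK; apply: (proj1 (state_gap st2 _)).
    by rewrite inE yK orbT.
have -> : weave C Q = weave (c :: K' ++ D) Q by rewrite CE EK.
apply: reach_le (reach_trans r1 (reach_trans r2 r3)).
rewrite size_drop leq_add // ?leq_add2l //.
  by rewrite (leq_trans (surplus_le K uw)) // EK /= sK'.
(* The first entry of [v] is one of the [(size Q).+1] small values, so its index is at most
   [size Q]. *)
rewrite leq_add2r -ltnS -sK' -[(size K').+1]/(size (c :: K')) index_mem.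
have cv : v != [::].
  by apply/eqP => v0; have := perm_size (st_low st1); rewrite v0.
have Sdv : ~~ S (head h v) := has_peaks_head (st_peaks st1) (state_all st1).
have -> : head 0 v = head h v by case: (v) cv.
by rewrite -(state_mem st1 Sdv); case: (v) cv => // *; rewrite mem_head.
Qed.

End Sorting.

(** * Permutations as words *)

(** The case distinction is that of [canonical_fun], ready for the comparison in
    [word_canonical]. *)
Lemma nth_weave cs ss i : size ss < size cs ->
  nth 0 (weave cs ss) i =
  if i < 2 * size ss then
    if odd i then nth 0 ss i./2 else nth 0 cs i./2
  else nth 0 cs (i - size ss).
Proof.
elim: ss cs i => [|s ss IH] [|c cs] i //=; first by rewrite subn0.
case: i => [|[|i]] sz; rewrite mulnS //= IH // negbK !ltnS subSS.
by case: ifP => // hi; have -> : i.+1 - size ss = (i - size ss).+1 by lia.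
Qed.

Lemma size_weave cs ss : size ss < size cs ->
  size (weave cs ss) = size cs + size ss.
Proof.
elim: ss cs => [|s ss IH] [|c cs] //= sz; first by rewrite addn0.
by rewrite IH // addnS.
Qed.

Section Permutations.

Variables (n : nat).
Implicit Types (pi : 'S_n) (X : {set 'I_n}).

(** Values count from 0 here, so the borders n + 1 and n + 2 turn into [n] and [n.+1]. *)
Definition word pi : seq nat := [seq val (pi i) | i <- enum 'I_n].

Definition values X : seq nat := [seq val i | i <- enum X].

Lemma size_word pi : size (word pi) = n.
Proof. by rewrite size_map size_enum_ord. Qed.

Lemma nth_word d pi (i : 'I_n) : nth d (word pi) i = pi i.
Proof. by rewrite (nth_map i) ?size_enum_ord // nth_ord_enum. Qed.

Lemma word_inj : injective word.
Proof. by move=> p q e; apply/permP => i; apply: val_inj; rewrite /= -!(nth_word 0) e. Qed.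

Lemma uniq_word pi : uniq (word pi).
Proof. by rewrite map_inj_uniq ?enum_uniq // => i j /val_inj/perm_inj. Qed.

Lemma mem_values X (i : 'I_n) : (val i \in values X) = (i \in X).
Proof. by rewrite mem_map ?mem_enum //; apply: val_inj. Qed.

Lemma values_lt X y : y \in values X -> y < n.
Proof. by case/mapP => i _ ->; apply: ltn_ord. Qed.

Lemma sorted_values X : sorted ltn (values X).
Proof.
apply: (subseq_sorted ltn_trans _ (iota_ltn_sorted 0 n)).
by rewrite -val_enum_ord map_subseq // enumT filter_subseq.
Qed.

Lemma filter_word pi X (q : pred nat) : (forall i : 'I_n, q (val i) = (i \in X)) ->
  perm_eq (filter q (word pi)) (values X).
Proof.
move=> qX; apply: uniq_perm.
- exact: filter_uniq (uniq_word pi).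
- by rewrite map_inj_uniq ?enum_uniq //; apply: val_inj.
move=> y; rewrite mem_filter; apply/andP/idP => [[qy /mapP[i _ yE]]|/mapP[i]].
  by rewrite yE in qy *; rewrite mem_values -qX.
rewrite mem_enum => iX ->; rewrite qX; split=> //; apply/mapP.
by exists ((pi^-1)%g i); rewrite ?mem_enum // permKV.
Qed.

(** The default value of [nth] serves as the right border. *)
Lemma extE pi k : ext pi k = (nth n.+1 (n :: word pi) k).+1.
Proof.
case: k => //= k; rewrite /ext /=; case: insubP => [i _ <-|] /=.
  by rewrite nth_word.
by rewrite -leqNgt => nk; rewrite nth_default // size_word.
Qed.

Lemma has_peaks_nth q l w r : reflect
  (forall i, i < size w -> peak_ok q (nth 0 (l :: w) i) (nth 0 w i) (nth r w i.+1))
  (has_peaks q l w r).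
Proof.
elim: w l => [|b w IH] l /=; first by apply: ReflectT.
apply: (iffP andP) => [[hb /IH hw] [|i]|hw].
- by case: (w) hb.
- by move/hw.
split; first by have := hw 0 isT; case: (w).
by apply/IH => i iw; have := hw i.+1 iw.
Qed.

(** [has_peaks] tests each position; as every value has exactly one position, this decides
    membership in the pinnacle set for every value. *)
Lemma pinnacle_has_peaks pi X :
  (pinnacle_set pi == X) = has_peaks (fun y => y \in values X) n (word pi) n.+1.
Proof.
have pE i : (pi i \in pinnacle_set pi) =
    (nth 0 (n :: word pi) i < nth 0 (word pi) i) &&
    (nth n.+1 (word pi) i.+1 < nth 0 (word pi) i).
  rewrite mem_imset; last exact: perm_inj.
  rewrite inE !extE !ltnS /= !nth_word; congr (_ && _).
  by rewrite (set_nth_default 0) //= size_word ltnS ltnW.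
apply/eqP/has_peaks_nth => [<- i|hw].
  rewrite size_word => lt_i; have := pE (Ordinal lt_i); rewrite /= /peak_ok => <-.
  by rewrite (nth_word 0 pi (Ordinal lt_i)) mem_values.
apply/setP => j; rewrite -[j](permKV pi) pE.
have := hw ((pi^-1)%g j); rewrite size_word ltn_ord => /(_ isT).
by rewrite /peak_ok nth_word permKV mem_values => /eqP.
Qed.

End Permutations.

(** * From words back to reversals of permutations *)

Lemma reversal_word n (pi : 'S_n) A B C : word pi = A ++ B ++ C -> B != [::] ->
  exists w1 w2, position pi w1 <= position pi w2 /\
    word (reversal pi w1 w2) = A ++ rev B ++ C.
Proof.
move=> wE Bn; have B0 : 0 < size B by case: (B) Bn.
have szn : size A + (size B + size C) = n by rewrite -(size_word pi) wE !size_cat.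
have lta : size A < n by lia.
have ltb : size A + (size B).-1 < n by lia.
(* The witnesses are the first and the last entry of the nonempty block [B]. *)
exists (pi (Ordinal lta)), (pi (Ordinal ltb)).
rewrite /position !permK leq_addr; split=> //.
apply: (@eq_from_nth _ 0); first by rewrite size_word !size_cat size_rev szn.
rewrite size_word => i lt_i; rewrite (nth_word 0 _ (Ordinal lt_i)).
rewrite permM permE /position !permK /revpos /=.
rewrite -(nth_word 0) wE !nth_cat size_rev.
have [ia|ia] /= := leqP (size A) i; last by rewrite ia.
have [ib|ib] := leqP i (size A + (size B).-1).
  have lj : size A + (size A + (size B).-1) - i < n by lia.
  rewrite val_insubd lj.
  have -> : size A + (size A + (size B).-1) - i < size A = false by lia.
  have hi : i - size A < size B by lia.
  rewrite hi nth_rev //.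
  have -> : size A + (size A + (size B).-1) - i - size A = size B - (i - size A).+1 by lia.
  by have -> : size B - (i - size A).+1 < size B by lia.
rewrite ltnNge ia /=.
by have -> : i - size A < size B = false by lia.
Qed.

(** The peak condition kept at every step is balancedness, by [pinnacle_has_peaks]. Steps with an
    empty block are dropped, since a reversal acts on at least one entry. *)
Lemma reach_reversals n (X : {set 'I_n}) k (pi : 'S_n) w :
  reach (fun y => y \in values X) n n.+1 k (word pi) w -> pinnacle_set pi = X ->
  exists R, [/\ all_balanced pi R, word (apply_reversals pi R) = w & size R <= k].
Proof.
move eu: (word pi) => u r; elim: r pi eu => {k u w} [k u|k A B C w hp _ IH] pi eu hX.
  by exists [::].
have [B0|Bn] := eqVneq B [::].
  have [|R [h1 h2 h3]] := IH pi _ hX; first by rewrite eu B0.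
  by exists R; split=> //; apply: leqW.
have [w1 [w2 [hpos hw]]] := reversal_word eu Bn.
have hX' : pinnacle_set (reversal pi w1 w2) = X.
  by apply/eqP; rewrite pinnacle_has_peaks hw.
have [R [h1 h2 h3]] := IH _ hw hX'.
exists ((w1, w2) :: R); split=> //=.
by rewrite h1 andbT /balanced hpos hX' hX eqxx.
Qed.

Lemma word_canonical n (X : {set 'I_n}) : #|X| < #|~: X| ->
  word (canonical X) = weave (values (~: X)) (values X).
Proof.
move=> hX; have cX := cardsC X; rewrite card_ord in cX.
have sX : size (values X) = #|X| by rewrite size_map -cardE.
have sC : size (values (~: X)) = #|~: X| by rewrite size_map -cardE.
apply: (@eq_from_nth _ 0); first by rewrite size_word size_weave ?sX ?sC // addnC.
rewrite size_word => i lt_i; rewrite (nth_word 0 _ (Ordinal lt_i)).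
rewrite canonicalE; last by lia.
rewrite nth_weave ?sX ?sC // /canonical_fun /=.
have [i1|i1] := ltnP i (2 * #|X|).
  have hi : i./2 < #|X| by rewrite ltn_half_double -mul2n.
  case: ifP => _; rewrite (nth_map (Ordinal lt_i)) // -cardE //.
  exact: ltn_trans hX.
rewrite (nth_map (Ordinal lt_i)) // -cardE.
by move: #|X| #|~: X| i1 cX lt_i => d e; lia.
Qed.

Theorem theorem1 (n : nat) (hn : 1 <= n) (pi : 'S_n) (S : {set 'I_n}) (p : nat)
    (hS : pinnacle_set pi = S) (hp : #|S| = p) :
  exists R : seq ('I_n * 'I_n),
    [/\ all_balanced pi R,
        apply_reversals pi R = canonical S,
        1 <= p -> size R <= 2 * n - minn p 3
      & p = 0 -> size R <= 2 * n - 1].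
Proof.
have sS : size (values S) = p by rewrite size_map -cardE.
have sC : size (values (~: S)) = n - p.
  by rewrite size_map -cardE cardsCs setCK card_ord hp.
have hpr : has_peaks (fun y => y \in values S) n (word pi) n.+1.
  by rewrite -pinnacle_has_peaks hS.
have [] := sort_word (@values_lt n S) (leqnSn n) hpr _ (uniq_word pi)
  (sorted_values (~: S)) _ (sorted_values S) (filter_word pi _) (filter_word pi _).
- by rewrite -size_eq0 size_word -lt0n.
- by apply/allP => y /values_lt.
- by move=> i; rewrite /= mem_values in_setC.
- by move=> i; rewrite /= mem_values.
rewrite sS sC => lt_p r; have [R [bR eR sR]] := reach_reversals r hS.
have lt_p' : #|S| < #|~: S| by rewrite hp cardsCs setCK card_ord hp.
exists R; split=> //.
- by apply: word_inj; rewrite eR word_canonical.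
(* As p < n - p, the bound adds up to 2n - 3 for p at least 1, and to 2n - 1 for p = 0. *)
- by move=> p0; move: sR; lia.
- by move=> p0; move: sR; rewrite p0; lia.
Qed.
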